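(* Let $N\ge1$ and $\beta\in\mathbb C$ with $\beta^4=(-1)^N$. The modular tensor category of finite-dimensional left modules over the symplectic fermion ribbon quasi-Hopf algebra $\mathsf Q(N,\beta)$ is prime.
   Context: Definitions: a topologising subcategory of an abelian category is a full subcategory closed under finite direct sums and subquotients. A tensor subcategory of a tensor category is a subcategory closed under tensor products and containing the tensor unit. A braided finite tensor category is factorisable if the Hopf pairing on its coend $\int^XX^\vee\otimes X$ induced by the double braiding is non-degenerate (equivalently, every object having trivial double braiding with all objects is a direct sum of copies of the unit). A modular tensor category is a factorisable ribbon finite tensor category (not necessarily semisimple). A modular tensor category $\mathcal C$ is prime if it has no proper non-trivial (i.e. not equivalent to $\mathcal C$ or to $\mathsf{Vect}$) topologising tensor subcategory which is factorisable with respect to the braiding inherited from $\mathcal C$. Algebra: $\mathsf{Q}(N,\beta)$ is the unital $\mathbb{C}$-algebra generated by $\mathsf{K},\mathsf{f}_i^\pm$ ($1\le i\le N$) with relations, for $\boldsymbol e_0=\frac12(1+\mathsf K^2)$, $\boldsymbol e_1=\frac12(1-\mathsf K^2)$: $\{\mathsf f_i^\pm,\mathsf K\}=0$, $\{\mathsf f_i^+,\mathsf f_j^-\}=\delta_{ij}\boldsymbol e_1$, $\{\mathsf f_i^\pm,\mathsf f_j^\pm\}=0$, $\mathsf K^4=1$. Quasi-Hopf structure: $\Delta(\mathsf K)=\mathsf K\otimes\mathsf K-(1+(-1)^N)\boldsymbol e_1\mathsf K\otimes\boldsymbol e_1\mathsf K$, $\Delta(\mathsf f_i^\pm)=\mathsf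 f_i^\pm\otimes1+\omega_\pm\otimes\mathsf f_i^\pm$ with $\omega_\pm=(\boldsymbol e_0\pm i\boldsymbol e_1)\mathsf K$; $\varepsilon(\mathsf K)=1$, $\varepsilon(\mathsf f_i^\pm)=0$; with $\boldsymbol\beta_\pm=\boldsymbol e_0+\beta^2(\pm i\mathsf K)^N\boldsymbol e_1$, $\Phi^{\pm1}=1\otimes1\otimes1+\boldsymbol e_1\otimes\boldsymbol e_1\otimes\{\boldsymbol e_0(\mathsf K^N-1)+\boldsymbol e_1(\boldsymbol\beta_\pm-1)\}$; $S(\mathsf K)=\mathsf K^{(-1)^N}$, $S(\mathsf f_i^\pm)=\mathsf f_i^\pm(\boldsymbol e_0\pm(-1)^Ni\boldsymbol e_1)\mathsf K$, $\boldsymbol\alpha=1$, $\boldsymbol\beta=\boldsymbol\beta_+$. $\mathsf R=\big(\sum_{n,m=0}^1\beta^{nm}\rho_{n,m}\,\boldsymbol e_n\otimes\boldsymbol e_m\big)\prod_{j}(1\otimes1-2\mathsf f_j^-\omega_-\otimes\mathsf f_j^+)$, $\rho_{n,m}=\frac12\sum_{k,l=0}^1(-1)^{kl}i^{-kn+lm}\mathsf K^k\otimes\mathsf K^l$. Ribbon element $\boldsymbol v=(\boldsymbol e_0-\beta i\mathsf K\boldsymbol e_1)\prod_j(1-2\mathsf f_j^+\mathsf f_j^-)$. Module category: tensor product via $\Delta$; associator $U(VW)\to(UV)W$ acts by $\Phi$; duals via $S,\boldsymbol\alpha,\boldsymbol\beta$; braiding $c(x\otimes y)=\mathsf R_2y\otimes\mathsf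 R_1x$; twist $\boldsymbol v^{-1}.(-)$. It is known that this category is modular. *)

(* Defs.v *)
(* Finite-dimensional modules are given by matrices acting on column vectors,
   over a field C containing the imaginary unit 'i; the intended instance is
   C = R[i] for R : realType. *)
From mathcomp Require Export all_boot all_order all_algebra.
From mathcomp Require Export reals.
From mathcomp Require Export complex mxtens.

Set Implicit Arguments.
Unset Strict Implicit.
Unset Printing Implicit Defensive.
Import Order.TTheory GRing.Theory Num.Theory.
Local Open Scope ring_scope.

Section Idempotents.
Variables (C : numClosedFieldType) (n : nat).
Implicit Type K : 'M[C]_n.

Definition e0 K : 'M[C]_n := 2^-1 *: (1 + K ^+ 2).
Definition e1 K : 'M[C]_n := 2^-1 *: (1 - K ^+ 2).
Definition omega_p K : 'M[C]_n := (e0 K + 'i *: e1 K) * K.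
Definition omega_m K : 'M[C]_n := (e0 K - 'i *: e1 K) * K.

End Idempotents.

(* The defining relations of Q(N, beta); they do not involve beta. *)
Record sf_relations (C : numClosedFieldType) (N n : nat)
    (K : 'M[C]_n) (fp fm : 'I_N -> 'M[C]_n) : Prop := SFRelations {
  sf_fpK : forall i, fp i * K + K * fp i = 0;
  sf_fmK : forall i, fm i * K + K * fm i = 0;
  sf_fpfm : forall i j, fp i * fm j + fm j * fp i = (i == j)%:R *: e1 K;
  sf_fpfp : forall i j, fp i * fp j + fp j * fp i = 0;
  sf_fmfm : forall i j, fm i * fm j + fm j * fm i = 0;
  sf_K4 : K ^+ 4 = 1 }.

(* A left Q(N, beta)-module on C^qdim: as the algebra is presented by
   generators and relations, an action is a choice of operators for the
   generators which satisfies the relations. *)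
Record qmodule (C : numClosedFieldType) (N : nat) := QModule {
  qdim : nat;
  qK : 'M[C]_qdim;
  qfp : 'I_N -> 'M[C]_qdim;
  qfm : 'I_N -> 'M[C]_qdim;
  qrel : sf_relations qK qfp qfm }.

Lemma scAl (C : numClosedFieldType) n (a : C) (A B : 'M[C]_n) :
  a *: (A * B) = (a *: A) * B.
Proof. exact: scalemxAl. Qed.

Lemma scAr (C : numClosedFieldType) n (a : C) (A B : 'M[C]_n) :
  a *: (A * B) = A * (a *: B).
Proof. exact: scalemxAr. Qed.

Section TensorLemmas.
Variables (C : numClosedFieldType) (m n : nat).
Implicit Types (A : 'M[C]_m) (B : 'M[C]_n).

Lemma tensMM A A' B B' : (A *t B) * (A' *t B') = (A * A') *t (B * B').
Proof. exact: tensmx_mul. Qed.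

Lemma tensDl A A' B : (A + A') *t B = A *t B + A' *t B.
Proof. by apply/matrixP=> i j; rewrite !mxE mulrDl. Qed.

Lemma tensDr A B B' : A *t (B + B') = A *t B + A *t B'.
Proof. by apply/matrixP=> i j; rewrite !mxE mulrDr. Qed.

Lemma tensZl a A B : (a *: A) *t B = a *: (A *t B).
Proof. by apply/matrixP=> i j; rewrite !mxE mulrA. Qed.

Lemma tensZr a A B : A *t (a *: B) = a *: (A *t B).
Proof. by apply/matrixP=> i j; rewrite !mxE mulrCA. Qed.

Lemma tensNl A B : (- A) *t B = - (A *t B).
Proof. by rewrite -scaleN1r tensZl scaleN1r. Qed.

Lemma tensNr A B : A *t (- B) = - (A *t B).
Proof. by rewrite -scaleN1r tensZr scaleN1r. Qed.

Lemma tens0l B : (0 : 'M[C]_m) *t B = 0.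
Proof. exact: tens0mx. Qed.

Lemma tens0r A : A *t (0 : 'M[C]_n) = 0.
Proof. exact: tensmx0. Qed.

Lemma tens11 : (1 : 'M[C]_m) *t (1 : 'M[C]_n) = 1.
Proof.
apply/matrixP=> i j; case: (mxtens_indexP i) => i1 i2.
case: (mxtens_indexP j) => j1 j2; rewrite tensmxE !mxE.
rewrite (can_eq (@mxtens_indexK _ _)) xpair_eqE.
by case: eqP; case: eqP; rewrite ?mulr1 ?mulr0.
Qed.

End TensorLemmas.

Section Algebra.
Variables (C : numClosedFieldType) (n : nat) (K : 'M[C]_n).
Hypothesis K4 : K ^+ 4 = 1.

Lemma e0E : e0 K = 2^-1 *: (1 + K ^+ 2).
Proof. by []. Qed.

Lemma e1E : e1 K = 2^-1 *: (1 - K ^+ 2).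
Proof. by []. Qed.

Lemma half2 : 2^-1 * 2 = 1 :> C.
Proof. by rewrite mulVf // pnatr_eq0. Qed.

Lemma K2K2 : K ^+ 2 * K ^+ 2 = 1.
Proof. by rewrite -exprD. Qed.

Lemma e0De1 : e0 K + e1 K = 1.
Proof.
by rewrite /e0 /e1 -scalerDr addrACA subrr addr0 -mulr2n -scaler_nat scalerA
  half2 scale1r.
Qed.

Lemma e0Be1 : e0 K - e1 K = K ^+ 2.
Proof.
rewrite /e0 /e1 -scalerBr opprB addrC addrA subrK.
by rewrite -mulr2n -scaler_nat scalerA half2 scale1r.
Qed.

Lemma e1K2 : e1 K * K ^+ 2 = - e1 K.
Proof. by rewrite /e1 -scAl mulrBl mul1r K2K2 -scalerN opprB. Qed.

Lemma e0K2 : e0 K * K ^+ 2 = e0 K.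
Proof. by rewrite /e0 -scAl mulrDl mul1r K2K2 addrC. Qed.

Lemma e1e1 : e1 K * e1 K = e1 K.
Proof.
rewrite {2}e1E -scAr mulrBr mulr1 e1K2 opprK -mulr2n -scaler_nat scalerA.
by rewrite half2 scale1r.
Qed.

Lemma e0e1 : e0 K * e1 K = 0.
Proof. by rewrite e1E -scAr mulrBr mulr1 e0K2 subrr scaler0. Qed.

Lemma comm_e1K : K * e1 K = e1 K * K.
Proof. by rewrite /e1 -scAr -scAl mulrBr mulrBl mulr1 mul1r -exprS -exprSr. Qed.

Lemma comm_e0K : K * e0 K = e0 K * K.
Proof. by rewrite /e0 -scAr -scAl mulrDr mulrDl mulr1 mul1r -exprS -exprSr. Qed.

Lemma comm_omega a b : (e0 K + a *: e1 K) * K = K * (e0 K + a *: e1 K) ->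
  (e0 K + a *: e1 K) * K * ((e0 K + b *: e1 K) * K)
  = (e0 K - (a * b) *: e1 K).
Proof.
move=> h; rewrite h -mulrA [X in K * X]mulrA.
have -> : (e0 K + a *: e1 K) * (e0 K + b *: e1 K) = e0 K + (a * b) *: e1 K.
  have e1e0 : e1 K * e0 K = 0.
    by rewrite e0E -scAr mulrDr mulr1 e1K2 addrN scaler0.
  have e0e0 : e0 K * e0 K = e0 K.
    rewrite {2}e0E -scAr mulrDr mulr1 e0K2 -mulr2n -scaler_nat scalerA.
    by rewrite half2 scale1r.
  rewrite mulrDl !mulrDr -!(scAl a) -!(scAr b); rewrite e0e0 e0e1 e1e0 e1e1.
  by rewrite !scaler0 addr0 add0r scalerA.
rewrite mulrDl mulrDr -(scAl (a * b)) -(scAr (a * b)) mulrA comm_e0K mulrA comm_e1K.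
by rewrite -!mulrA -!expr2 e0K2 e1K2 scalerN.
Qed.

Lemma omegaK a : (e0 K + a *: e1 K) * K = K * (e0 K + a *: e1 K).
Proof. by rewrite mulrDl mulrDr -(scAl a) -(scAr a) comm_e0K comm_e1K. Qed.

Lemma omega_commK a : (e0 K + a *: e1 K) * K * K = K * ((e0 K + a *: e1 K) * K).
Proof. by rewrite mulrA -omegaK. Qed.

Lemma omega_pm : omega_p K * omega_m K = K ^+ 2.
Proof.
rewrite /omega_p /omega_m -scaleNr comm_omega; last exact: omegaK.
by rewrite mulrN -expr2 sqrCi opprK scale1r e0Be1.
Qed.

Lemma omega_mp : omega_m K * omega_p K = K ^+ 2.
Proof.
rewrite /omega_p /omega_m -scaleNr comm_omega; last exact: omegaK.
by rewrite mulNr -expr2 sqrCi opprK scale1r e0Be1.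
Qed.

Lemma comm_omega_e1K a :
  (e0 K + a *: e1 K) * K * (e1 K * K) = e1 K * K * ((e0 K + a *: e1 K) * K).
Proof.
have h : (e0 K + a *: e1 K) * e1 K = e1 K * (e0 K + a *: e1 K).
  have -> : e0 K = 1 - e1 K by rewrite -e0De1 addrK.
  by rewrite !mulrDl !mulrDr -(scAl a) -(scAr a) mulNr mulrN mul1r mulr1.
set w := e0 K + _ in h *.
rewrite mulrA -(mulrA w) comm_e1K mulrA h [RHS]mulrA -(mulrA (e1 K) K w).
by rewrite -omegaK mulrA.
Qed.

Lemma swap_anti (f g : 'M[C]_n) : f * g + g * f = 0 -> f * g = - (g * f).
Proof. by move=> h; apply/eqP; rewrite -subr_eq0 opprK h. Qed.

Variable f : 'M[C]_n.
Hypothesis fK : f * K + K * f = 0.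

Lemma anti_K2 : f * K ^+ 2 = K ^+ 2 * f.
Proof.
rewrite expr2 [LHS]mulrA (swap_anti fK) mulNr -[K * f * K]mulrA (swap_anti fK).
by rewrite mulrN opprK mulrA.
Qed.

Lemma comm_e0f : f * e0 K = e0 K * f.
Proof. by rewrite /e0 -scAr -scAl mulrDr mulrDl mulr1 mul1r anti_K2. Qed.

Lemma comm_e1f : f * e1 K = e1 K * f.
Proof. by rewrite /e1 -scAr -scAl mulrBr mulrBl mulr1 mul1r anti_K2. Qed.

Lemma anti_omega a : f * ((e0 K + a *: e1 K) * K) + (e0 K + a *: e1 K) * K * f = 0.
Proof.
have h : f * (e0 K + a *: e1 K) = (e0 K + a *: e1 K) * f.
  by rewrite mulrDr mulrDl -(scAl a) -(scAr a) comm_e0f comm_e1f.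
by rewrite mulrA h -!mulrA -mulrDr fK mulr0.
Qed.

Lemma anti_omega_p : f * omega_p K + omega_p K * f = 0.
Proof. exact: anti_omega. Qed.

Lemma anti_omega_m : f * omega_m K + omega_m K * f = 0.
Proof. by rewrite /omega_m -scaleNr; apply: anti_omega. Qed.

Lemma anti_e1K : f * (e1 K * K) + e1 K * K * f = 0.
Proof. by rewrite mulrA comm_e1f -!mulrA -mulrDr fK mulr0. Qed.

End Algebra.

Section Modules.
Variables (C : numClosedFieldType) (N : nat).
Local Notation qmodule := (qmodule C N).
Implicit Types V W : qmodule.

Lemma unit_rel : sf_relations (1 : 'M[C]_1) (fun _ : 'I_N => 0) (fun _ => 0).
Proof.
by split=> *; rewrite ?(mulr0, mul0r, addr0, expr1n) // /e1 expr1n subrr !scaler0.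
Qed.

Definition qunit : qmodule := QModule unit_rel.

Lemma zero_rel : sf_relations (0 : 'M[C]_0) (fun _ : 'I_N => 0) (fun _ => 0).
Proof. by split=> *; rewrite [LHS]flatmx0 [RHS]flatmx0. Qed.

Definition qzero : qmodule := QModule zero_rel.

Definition dsum (m n : nat) (A : 'M[C]_m) (B : 'M[C]_n) : 'M[C]_(m + n) :=
  block_mx A 0 0 B.

Lemma dsumD m n (A A' : 'M[C]_m) (B B' : 'M[C]_n) :
  dsum A B + dsum A' B' = dsum (A + A') (B + B').
Proof. by rewrite /dsum add_block_mx !addr0. Qed.

Lemma dsumM m n (A A' : 'M[C]_m) (B B' : 'M[C]_n) :
  dsum A B * dsum A' B' = dsum (A * A') (B * B').
Proof.
rewrite /dsum -!mulmxE (mulmx_block A 0 0 B A' 0 0 B').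
by rewrite !mulmx0 !mul0mx !addr0 !add0r.
Qed.

Lemma dsumZ m n a (A : 'M[C]_m) (B : 'M[C]_n) :
  a *: dsum A B = dsum (a *: A) (a *: B).
Proof. by rewrite /dsum scale_block_mx !scaler0. Qed.

Lemma dsum0 m n : dsum (0 : 'M[C]_m) (0 : 'M[C]_n) = 0.
Proof. exact: block_mx0. Qed.

Lemma dsum1 m n : dsum (1 : 'M[C]_m) (1 : 'M[C]_n) = 1.
Proof. exact: esym (scalar_mx_block m n 1). Qed.

Lemma dsumX m n (A : 'M[C]_m) (B : 'M[C]_n) k :
  dsum A B ^+ k = dsum (A ^+ k) (B ^+ k).
Proof. by elim: k => [|k IH]; rewrite ?expr0 ?dsum1 // !exprS IH dsumM. Qed.

Lemma dsum_e1 m n (A : 'M[C]_m) (B : 'M[C]_n) :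
  e1 (dsum A B) = dsum (e1 A) (e1 B).
Proof.
by rewrite /e1 dsumX -scaleN1r dsumZ -dsum1 dsumD dsumZ !scaleN1r.
Qed.

Lemma qsum_rel V W :
  sf_relations (dsum (qK V) (qK W)) (fun i => dsum (qfp V i) (qfp W i))
    (fun i => dsum (qfm V i) (qfm W i)).
Proof.
case: V W => m K fp fm [a b c d e h] [n L gp gm [a' b' c' d' e' h']] /=.
split=> *; rewrite ?dsumX ?dsumM ?dsumD ?dsum_e1 ?dsumZ.
- by rewrite a a' dsum0.
- by rewrite b b' dsum0.
- by rewrite c c'.
- by rewrite d d' dsum0.
- by rewrite e e' dsum0.
- by rewrite h h' dsum1.
Qed.

Definition qsum V W : qmodule := QModule (qsum_rel V W).

Definition qcopies (n : nat) V : qmodule := iter n (qsum V) qzero.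

(* The actions of Delta(K), Delta(f_i^+), Delta(f_i^-) on the tensor product. *)
Definition tK V W : 'M[C]_(qdim V * qdim W) :=
  qK V *t qK W
  - (1 + (-1) ^+ N) *: ((e1 (qK V) * qK V) *t (e1 (qK W) * qK W)).
Definition tfp V W (i : 'I_N) : 'M[C]_(qdim V * qdim W) :=
  qfp V i *t (1 : 'M[C]_(qdim W)) + omega_p (qK V) *t qfp W i.
Definition tfm V W (i : 'I_N) : 'M[C]_(qdim V * qdim W) :=
  qfm V i *t (1 : 'M[C]_(qdim W)) + omega_m (qK V) *t qfm W i.

Lemma tK2 V W : tK V W ^+ 2 = (qK V ^+ 2) *t (qK W ^+ 2).
Proof.
have hV := sf_K4 (qrel V); have hW := sf_K4 (qrel W).
have E n (K : 'M[C]_n) (h : K ^+ 4 = 1) :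
    [/\ K * (e1 K * K) = - e1 K, e1 K * K * K = - e1 K
      & e1 K * K * (e1 K * K) = - e1 K].
  have h1 : e1 K * K * K = - e1 K by rewrite -mulrA -expr2 e1K2.
  split=> //; first by rewrite mulrA comm_e1K h1.
  by rewrite -mulrA (mulrA K) comm_e1K h1 mulrN e1e1.
have [a b c] := E _ _ hV; have [a' b' c'] := E _ _ hW.
rewrite /tK; set t := 1 + _.
have tt : t * t = t + t.
  rewrite /t -signr_odd; case: (odd N) => /=; last by rewrite expr0 mulrDl !mul1r.
  by rewrite expr1 subrr mul0r addr0.
rewrite expr2 mulrBr !mulrBl -!(scAr t) -!(scAl t) !tensMM a a' b b' c c'.
rewrite !tensNl !tensNr !opprK scalerA tt (scalerDl _ t t).
by rewrite opprB addrK subrK.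
Qed.

Lemma qtens_rel V W : sf_relations (tK V W) (tfp V W) (tfm V W).
Proof.
have e1E : e1 (tK V W) = e1 (qK V) *t 1 + (qK V ^+ 2) *t e1 (qK W).
  rewrite /e1 tK2 tensZl tensZr -scalerDr; congr (_ *: _).
  by rewrite tensDl tensDr tensNl tensNr tens11 addrA subrK.
have K4E : tK V W ^+ 4 = 1.
  by rewrite (exprM _ 2 2) tK2 expr2 tensMM !K2K2 ?tens11 //;
    apply: sf_K4 (qrel _).
case: V W e1E K4E => m K fp fm [a b c d e h] [n L gp gm [a' b' c' d' e' h']].
rewrite /tfp /tfm /= => e1E K4E.
have anti1 (f : 'M[C]_m) (w : 'M[C]_m) (g : 'M[C]_n) :
    f * w + w * f = 0 -> (f *t 1) * (w *t g) + (w *t g) * (f *t 1) = 0.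
  by move=> fw; rewrite !tensMM mul1r mulr1 -tensDl fw tens0l.
have FF (Q f f' w w' : 'M[C]_m) (g g' : 'M[C]_n) :
    f * w' + w' * f = 0 -> f' * w + w * f' = 0 -> w * w' = Q ->
    w' * w = Q ->
    (f *t 1 + w *t g) * (f' *t 1 + w' *t g')
    + (f' *t 1 + w' *t g') * (f *t 1 + w *t g)
    = (f * f' + f' * f) *t 1 + Q *t (g * g' + g' * g).
  move=> h1 h2 w1 w2; rewrite !mulrDl !mulrDr.
  have E (x y z t x' y' z' t' : 'M[C]_(m * n)) : y + z' = 0 -> z + y' = 0 ->
      x + y + (z + t) + (x' + y' + (z' + t')) = x + x' + (t + t').
    move=> yz zy.
    rewrite [LHS](AC ((2*2)*(2*2)) ((1*5)*(4*8)*((2*7)*(3*6)))) /=.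
    by rewrite yz zy !addr0.
  rewrite E; first 1 last.
  - exact: anti1.
  - by rewrite addrC; apply: anti1.
  by rewrite !tensMM w1 w2 !mulr1 -tensDl -tensDr.
have FK (f w K' : 'M[C]_m) (g L' : 'M[C]_n) :
    f * K' + K' * f = 0 -> g * L' + L' * g = 0 -> w * K' = K' * w ->
    (f *t 1 + w *t g) * (K' *t L') + (K' *t L') * (f *t 1 + w *t g) = 0.
  move=> h1 h2 h3; rewrite mulrDl mulrDr !tensMM mul1r mulr1 h3 addrACA.
  by rewrite -tensDl -tensDr h1 h2 tens0l tens0r addr0.
have FT (t : C) (X A B : 'M[C]_(m * n)) : X * A + A * X = 0 ->
    X * B + B * X = 0 -> X * (A - t *: B) + (A - t *: B) * X = 0.
  move=> h1 h2; rewrite mulrBr mulrBl -(scAr t) -(scAl t) addrACA h1.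
  by rewrite -opprD -scalerDr h2 scaler0 subr0.
have wmE (p : nat) (M : 'M[C]_p) : omega_m M = (e0 M + (- 'i) *: e1 M) * M.
  by rewrite /omega_m scaleNr.
split=> [i|i|i j|i j|i j|] //.
- apply: FT; apply: FK => //; [exact: omega_commK | exact: anti_e1K..|].
  exact: comm_omega_e1K.
- apply: FT; apply: FK => //; rewrite ?wmE;
    [exact: omega_commK | exact: anti_e1K..|].
  exact: comm_omega_e1K.
- rewrite (FF (K ^+ 2)) ?anti_omega_m ?anti_omega_p ?omega_pm ?omega_mp //.
  by rewrite c c' tensZl tensZr -scalerDr e1E.
- rewrite (FF (omega_p K ^+ 2)) ?anti_omega_p // d d'.
  by rewrite tens0l tens0r addr0.
- rewrite (FF (omega_m K ^+ 2)) ?anti_omega_m // e e'.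
  by rewrite tens0l tens0r addr0.
Qed.

Definition qtens V W : qmodule := QModule (qtens_rel V W).

(* An m x n matrix A is read as the map x |-> A *m x on column vectors. *)
Definition qhom V W (A : 'M[C]_(qdim W, qdim V)) : Prop :=
  [/\ A *m qK V = qK W *m A,
      forall i, A *m qfp V i = qfp W i *m A
    & forall i, A *m qfm V i = qfm W i *m A].

Definition qsub W V : Prop :=
  exists A : 'M[C]_(qdim V, qdim W),
    qhom A /\ injective (fun x : 'cV[C]_(qdim W) => A *m x).

Definition qquo W V : Prop :=
  exists A : 'M[C]_(qdim W, qdim V),
    qhom A /\ forall y : 'cV[C]_(qdim W), exists x, A *m x = y.

Definition qsubquo W V : Prop := exists U, qsub U V /\ qquo W U.

Definition qiso V W : Prop :=
  exists (A : 'M[C]_(qdim W, qdim V)) (B : 'M[C]_(qdim V, qdim W)),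
    [/\ qhom A, qhom B, A *m B = 1%:M & B *m A = 1%:M].

(* Full subcategories are identified with their classes of objects. *)
Definition topologising (D : qmodule -> Prop) : Prop :=
  [/\ D qzero,
      forall V W, D V -> D W -> D (qsum V W)
    & forall V W, D V -> qsubquo W V -> D W].

Definition tensor_subcategory (D : qmodule -> Prop) : Prop :=
  D qunit /\ forall V W, D V -> D W -> D (qtens V W).

Section Braiding.
Variable beta : C.

Definition e_ (p : nat) (K : 'M[C]_p) (a : 'I_2) : 'M[C]_p :=
  if a == 0 then e0 K else e1 K.

(* rho_{a,b} *)
Definition rho V W (a b : 'I_2) : 'M[C]_(qdim V * qdim W) :=
  2^-1 *: \sum_(k < 2) \sum_(l < 2)
    ((-1) ^+ (k * l) * ('i ^- (k * a) * 'i ^+ (l * b)))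
      *: ((qK V ^+ k) *t (qK W ^+ l)).

(* The action of the universal R-matrix on the tensor product. *)
Definition Rmx V W : 'M[C]_(qdim V * qdim W) :=
  (\sum_(a < 2) \sum_(b < 2)
     beta ^+ (a * b) *: (rho V W a b * (e_ (qK V) a *t e_ (qK W) b)))
  * \prod_(j < N)
      (1 - 2 *: ((qfm V j * omega_m (qK V)) *t qfp W j)).

(* x (x) y |-> y (x) x *)
Definition flip (m n : nat) : 'M[C]_(n * m, m * n) :=
  \matrix_(r, s) (((mxtens_unindex r).1 == (mxtens_unindex s).2)
    && ((mxtens_unindex r).2 == (mxtens_unindex s).1))%:R.

Definition braiding V W : 'M[C]_(qdim W * qdim V, qdim V * qdim W) :=
  flip (qdim V) (qdim W) *m Rmx V W.

Definition trivial_double_braiding V W : Prop :=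
  braiding W V *m braiding V W = 1%:M.

(* Non-degeneracy of the braiding inherited by D, in terms of the objects of D
   which are transparent to all of D.  Rigidity of D is not imposed, so that
   primality below also rules out subcategories not known to be rigid. *)
Definition factorisable (D : qmodule -> Prop) : Prop :=
  forall V, D V -> (forall W, D W -> trivial_double_braiding V W) ->
  exists n, qiso V (qcopies n qunit).

(* The inclusion of D, respectively the functor from Vect to D sending C^n to
   n copies of the unit object, is an equivalence.  Both functors are always
   fully faithful, so that this is essential surjectivity. *)
Definition equivalent_to_all (D : qmodule -> Prop) : Prop :=
  forall V, exists W, D W /\ qiso V W.
Definition equivalent_to_Vect (D : qmodule -> Prop) : Prop :=
  forall V, D V -> exists n, qiso V (qcopies n qunit).

(* The coassociator, the antipode and the ribbon element of Q(N, beta) are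
   not involved: on full subcategories, the conditions below only depend on
   the abelian structure, the tensor product, its unit and the braiding. *)
Definition prime_category : Prop :=
  ~ exists D : qmodule -> Prop,
      [/\ topologising D, tensor_subcategory D, factorisable D,
          ~ equivalent_to_all D & ~ equivalent_to_Vect D].

End Braiding.
End Modules.

(* Main.v *)
(* Let D be a topologising tensor subcategory, factorisable for the inherited
   braiding.
   If K^2 = 1 on all of D, then the one-dimensional module "sign" with K = -1
   is transparent to D, hence not in D; this forces K = 1 on every object of D,
   so the f's (which anticommute with K) vanish and D is Vect.
   Otherwise D contains some V <> 0 with K^2 = -1.  The product T of all
   f_i^+ f_i^- does not vanish on V (x) V, so that V (x) V is not a multiple of
   the unit and sign is in D; tensoring with sign changes K to -K.  Averaging
   the rank one maps U -> W, for W = V or W = V (x) V up to a sign of K, gives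
   enough morphisms to separate the points of any module U: it suffices to
   detect the vectors killed by all f's (where K^2 = 1), respectively by all
   f_i^- (where K^2 = -1).  So U embeds in an object of D. *)
Require Import Defs.
From mathcomp Require Import all_boot all_order all_algebra reals complex mxtens.
From mathcomp Require Import boolp.
Import Order.TTheory GRing.Theory Num.Theory.
Local Open Scope ring_scope.

Set Implicit Arguments.
Unset Strict Implicit.
Unset Printing Implicit Defensive.

(** * Sign rules for anticommuting matrices *)

Lemma eq_opp0 (C : numClosedFieldType) (U : lmodType C) (x : U) : x = - x -> x = 0.
Proof.
move/eqP; rewrite -addr_eq0 -mulr2n -scaler_nat scaler_eq0 pnatr_eq0 /=.
by move/eqP.
Qed.

Lemma mulmx_anti (C : numClosedFieldType) p q (x y : 'M[C]_p) (z : 'M[C]_(p, q)) :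
  x *m y = - (y *m x) -> x *m (y *m z) = - (y *m (x *m z)).
Proof. by move=> h; rewrite mulmxA h mulNmx mulmxA. Qed.

(** * Averaging a linear map for one pair of odd generators *)

Section Averaging.
Variables (C : numClosedFieldType) (m n : nat).
Variables (a b : 'M[C]_m) (a' b' : 'M[C]_n).
Implicit Type X : 'M[C]_(m, n).

(* X |-> sum_k x_k X y_k, for dual bases (x_k), (y_k) of the Frobenius algebra
   generated by a and b with a^2 = b^2 = 0 and a b + b a central: hence the
   result intertwines a with a' and b with b'. *)
Definition avg X : 'M[C]_(m, n) :=
  a *m b *m X - a *m X *m b' + b *m X *m a' - X *m b' *m a'.

(** Each of the four terms of [avg] contains two odd factors, so moving [g] across costs two signs.
    This serves for [K] and for the generators of the other indices. *)
Lemma avg_comm_odd (g : 'M[C]_m) (g' : 'M[C]_n) X :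
  g *m a = - (a *m g) -> g *m b = - (b *m g) ->
  g' *m a' = - (a' *m g') -> g' *m b' = - (b' *m g') ->
  g *m X = X *m g' -> g *m avg X = avg X *m g'.
Proof.
move=> ga gb ga' gb' gX.
have h1 : g *m (a *m b *m X) = a *m b *m X *m g'.
  by rewrite -!mulmxA (mulmx_anti _ ga) (mulmx_anti _ gb) mulmxN opprK gX.
have h2 : g *m (a *m X *m b') = a *m X *m b' *m g'.
  rewrite -!mulmxA (mulmx_anti _ ga) (mulmxA g) gX -mulmxA gb'.
  by rewrite !mulmxN opprK.
have h3 : g *m (b *m X *m a') = b *m X *m a' *m g'.
  rewrite -!mulmxA (mulmx_anti _ gb) (mulmxA g) gX -mulmxA ga'.
  by rewrite !mulmxN opprK.
have h4 : g *m (X *m b' *m a') = X *m b' *m a' *m g'.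
  rewrite -!mulmxA (mulmxA g) gX -mulmxA (mulmx_anti _ gb') ga'.
  by rewrite !mulmxN opprK.
by rewrite /avg mulmxBr mulmxDr mulmxBr h1 h2 h3 h4 mulmxBl mulmxDl mulmxBl.
Qed.

(** Both sides reduce to [a b X a' - a X b' a']. *)
Lemma avg_comm_a X :
  a *m a = 0 -> a' *m a' = 0 -> a *m avg X = avg X *m a'.
Proof.
move=> aa aa'; rewrite /avg mulmxBr mulmxDr mulmxBr mulmxBl mulmxDl mulmxBl.
rewrite !mulmxA aa !mul0mx -!mulmxA aa' !mulmx0 !subr0 add0r addr0.
by rewrite addrC.
Qed.

(** Both sides equal [b X a' b' - b a X b']. The condition on the anticommutators moves [X] across
    in [b a b X = b (a b + b a) X] and in [X b' a' b' = X (a' b' + b' a') b']. *)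
Lemma avg_comm_b X :
  b *m b = 0 -> b' *m b' = 0 ->
  (a *m b + b *m a) *m X = X *m (a' *m b' + b' *m a') ->
  b *m avg X = avg X *m b'.
Proof.
move=> bb bb' tX.
have h1 : b *m (a *m b *m X) = b *m X *m a' *m b' + b *m X *m b' *m a'.
  have := congr1 (mulmx b) tX; rewrite mulmxDl !mulmxDr -!mulmxA (mulmxA b b) bb.
  by rewrite mul0mx addr0.
have h2 : X *m b' *m a' *m b' = a *m b *m X *m b' + b *m a *m X *m b'.
  rewrite -mulmxDl -mulmxDl tX.
  by rewrite mulmxDr mulmxDl -!mulmxA bb' !mulmx0 add0r.
rewrite /avg mulmxBr mulmxDr mulmxBr h1 mulmxBl mulmxDl mulmxBl h2.
rewrite !mulmxA bb !mul0mx -[a *m X *m b' *m b']mulmxA bb' !mulmx0 subr0 addr0.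
by rewrite addrAC addrK opprD addrACA subrr add0r.
Qed.

End Averaging.

(** * Averaging over all indices *)

Section Relations.
Variables (C : numClosedFieldType) (N : nat).
Implicit Types V W : qmodule C N.

Lemma qfpK V i : qfp V i *m qK V = - (qK V *m qfp V i).
Proof. exact/swap_anti/(sf_fpK (qrel V)). Qed.

Lemma qfmK V i : qfm V i *m qK V = - (qK V *m qfm V i).
Proof. exact/swap_anti/(sf_fmK (qrel V)). Qed.

Lemma qfpfp V i j : qfp V i *m qfp V j = - (qfp V j *m qfp V i).
Proof. exact/swap_anti/(sf_fpfp (qrel V)). Qed.

Lemma qfmfm V i j : qfm V i *m qfm V j = - (qfm V j *m qfm V i).
Proof. exact/swap_anti/(sf_fmfm (qrel V)). Qed.

Lemma qfpfm V i j : i != j -> qfp V i *m qfm V j = - (qfm V j *m qfp V i).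
Proof.
move=> ij; apply/swap_anti; rewrite (sf_fpfm (qrel V)) (negPf ij).
exact: scale0r.
Qed.

Lemma qfpfp0 V i : qfp V i *m qfp V i = 0.
Proof. exact/eq_opp0/qfpfp. Qed.

Lemma qfmfm0 V i : qfm V i *m qfm V i = 0.
Proof. exact/eq_opp0/qfmfm. Qed.

Lemma qfpfm1 V i : qfp V i *m qfm V i + qfm V i *m qfp V i = e1 (qK V).
Proof. by have := sf_fpfm (qrel V) i i; rewrite eqxx scale1r. Qed.

Definition avgs W V (s : seq 'I_N) (X : 'M[C]_(qdim W, qdim V)) :=
  foldr (fun i Y => avg (qfp W i) (qfm W i) (qfp V i) (qfm V i) Y) X s.

Lemma e1_comm W V (X : 'M[C]_(qdim W, qdim V)) :
  qK W *m X = X *m qK V -> e1 (qK W) *m X = X *m e1 (qK V).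
Proof.
move=> KX; rewrite /e1 -scalemxAl -scalemxAr mulmxBl mulmxBr !expr2 -!mulmxE.
by rewrite -!idmxE mul1mx mulmx1 -mulmxA KX mulmxA KX mulmxA.
Qed.

Lemma avgs_K W V s (X : 'M[C]_(qdim W, qdim V)) :
  qK W *m X = X *m qK V -> qK W *m avgs s X = avgs s X *m qK V.
Proof.
move=> KX; elim: s => [//|i s IH] /=.
by apply: avg_comm_odd; rewrite ?qfpK ?qfmK ?opprK.
Qed.

(** Averaging for one index makes the map intertwine the two generators of that index, and later
    averages keep this, since generators of different indices anticommute. The anticommutator for
    each index is [e1], a polynomial in [K], so it is intertwined as soon as [K] is. *)
Lemma avgs_hom W V (X : 'M[C]_(qdim W, qdim V)) :
  qK W *m X = X *m qK V -> qhom (avgs (enum 'I_N) X).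
Proof.
move=> KX; have e1X s := e1_comm (avgs_K s KX).
have tX s i : (qfp W i *m qfm W i + qfm W i *m qfp W i) *m avgs s X
    = avgs s X *m (qfp V i *m qfm V i + qfm V i *m qfp V i).
  by rewrite !qfpfm1 e1X.
have P s i : i \in s -> qfp W i *m avgs s X = avgs s X *m qfp V i
    /\ qfm W i *m avgs s X = avgs s X *m qfm V i.
  elim: s => [//|j s IH]; rewrite inE; have [-> _|ij /= /IH [h1 h2]] := eqVneq.
    split; first by apply: avg_comm_a; exact: qfpfp0.
    by apply: avg_comm_b; rewrite ?qfmfm0 ?tX.
  have mp (U : qmodule C N) : qfm U i *m qfp U j = - (qfp U j *m qfm U i).
    by rewrite (@qfpfm U j i) ?opprK // eq_sym.
  by split; apply: avg_comm_odd;
    rewrite ?(qfpfp _ i) ?(qfmfm _ i) ?mp ?(qfpfm _ ij).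
have Q i := P _ i (mem_enum 'I_N i).
by split=> [|i|i]; [rewrite avgs_K | case: (Q i) | case: (Q i)].
Qed.

End Relations.

(** * Values of averaged maps on special vectors *)

Section Evaluation.
Variables (C : numClosedFieldType) (N : nat) (W V : qmodule C N).
Implicit Types (X : 'M[C]_(qdim W, qdim V)) (v : 'cV[C]_(qdim V)).

(** Of each average only the term [a b X] survives on a vector killed by all generators [f]. *)
Lemma avgs_socle s X v :
  (forall i, qfp V i *m v = 0) -> (forall i, qfm V i *m v = 0) ->
  avgs s X *m v = (\prod_(i <- s) (qfp W i * qfm W i)) *m (X *m v).
Proof.
move=> av bv; elim: s => [|i s IH] /=; first by rewrite big_nil -idmxE mul1mx.
rewrite big_cons /avg !(mulmxDl, mulNmx) -!mulmxA !(av, bv) !mulmx0.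
by rewrite oppr0 !addr0 IH -mulmxE !mulmxA.
Qed.

Lemma avgs_killed s X i : i \notin s ->
  qfm W i *m X = 0 -> qfm W i *m avgs s X = 0.
Proof.
move=> + bX; elim: s => [//|j s IH]; rewrite inE negb_or => /andP[ij /IH {}IH].
have ba : qfm W i *m qfp W j = - (qfp W j *m qfm W i).
  by rewrite (@qfpfm _ _ W j i) ?opprK // eq_sym.
rewrite /= /avg !(mulmxDr, mulmxN) -!mulmxA !(mulmx_anti _ ba).
rewrite !(mulmx_anti _ (qfmfm W i j)) !(mulmxA _ (avgs s X)) IH.
by rewrite !(mul0mx, mulmx0, oppr0, subr0, addr0).
Qed.

(** Of each average only [- X b' a'] survives: [b'] kills [v], [b] kills the image of [X] even after
    averages for other indices, and [b' a' v = e1 v = v]. *)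
Lemma avgs_vacuum s X v : uniq s -> e1 (qK V) *m v = v ->
  (forall i, qfm V i *m v = 0) -> (forall i, qfm W i *m X = 0) ->
  avgs s X *m v = (-1) ^+ size s *: (X *m v).
Proof.
move=> + e1v bv bX; elim: s => [|i s IH] /=; first by rewrite scale1r.
move=> /andP[si /IH {}IH]; have bY := avgs_killed si (bX i).
have bav : qfm V i *m (qfp V i *m v) = v.
  by rewrite -[RHS]e1v -(qfpfm1 V i) mulmxDl -!mulmxA bv mulmx0 add0r.
rewrite /avg !(mulmxDl, mulNmx) -!mulmxA bv !mulmx0 subr0 bav IH.
rewrite -scalemxAr (mulmxA (qfm W i) X) bX mul0mx scaler0 mulmx0 add0r.
by rewrite (mulmxA _ (avgs s X)) bY mul0mx sub0r exprS mulN1r scaleNr.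
Qed.

End Evaluation.

(** * Common kernels and eigenvectors *)

(** Run through the operators, replacing [x] by [F i *m x] unless this is zero. Anticommutation
    makes [F i] square to zero and preserves the vanishing already reached. It is asked on [S] only,
    because [f_i^+] and [f_i^-] anticommute only where [e1] vanishes. *)
Lemma common_kernel (C : numClosedFieldType) n (I : finType) (F : I -> 'M[C]_n)
    (S : 'cV[C]_n -> Prop) v :
  (forall i j x, S x -> F i *m (F j *m x) = - (F j *m (F i *m x))) ->
  (forall i x, S x -> S (F i *m x)) -> v != 0 -> S v ->
  exists x, [/\ x != 0, S x & forall i, F i *m x = 0].
Proof.
move=> FF SF v0 Sv.
suff [x [x0 Sx h]] : exists x, [/\ x != 0, S x & forall i, i \in enum I -> F i *m x = 0].
  by exists x; split=> // i; apply: h; rewrite mem_enum.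
elim: (enum I) => [|i s [x [x0 Sx h]]]; first by exists v.
have [e|ne] := eqVneq (F i *m x) 0.
  by exists x; split=> // j; rewrite inE => /predU1P[->|/h].
exists (F i *m x); split=> //; first exact: SF.
move=> j; rewrite inE => /predU1P[->|/h hj].
  exact/eq_opp0/FF.
by rewrite FF // hj mulmx0 oppr0.
Qed.

(** If nonzero, [mu v + M v] is an eigenvector for [mu] and [- mu v + M v] one for [- mu]; both
    cannot vanish, since their difference is [2 mu v]. *)
Lemma sqr_eigenvector (C : numClosedFieldType) n (M : 'M[C]_n)
    (S : 'cV[C]_n -> Prop) (mu : C) v :
  (forall c x y, S x -> S y -> S (c *: x + y)) ->
  (forall x, S x -> S (M *m x)) ->
  mu != 0 -> v != 0 -> S v -> M *m (M *m v) = mu ^+ 2 *: v ->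
  exists (lam : C) (x : 'cV[C]_n),
    [/\ lam = mu \/ lam = - mu, x != 0, S x & M *m x = lam *: x].
Proof.
move=> SD SM mu0 v0 Sv MMv.
have P lam : lam ^+ 2 = mu ^+ 2 ->
    M *m (lam *: v + M *m v) = lam *: (lam *: v + M *m v).
  move=> e; rewrite mulmxDr -scalemxAr MMv scalerDr scalerA -expr2 e.
  by rewrite addrC.
have [e|ne] := eqVneq (mu *: v + M *m v) 0; last first.
  exists mu, (mu *: v + M *m v).
  by split; [left | | apply/SD => //; exact: SM | exact: P].
exists (- mu), (- mu *: v + M *m v); split; [by right| | |].
- apply: contra_neq v0 => e'.
  have : (mu + mu) *: v = 0.
    rewrite -[RHS](subrr (0 : 'cV[C]_n)) -[X in X - _]e -e' scaleNr opprD opprK.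
    by rewrite addrACA subrr addr0 scalerDl.
  by move/eqP; rewrite scaler_eq0 -mulr2n mulrn_eq0 (negPf mu0) => /eqP.
- by apply/SD => //; exact: SM.
- by apply: P; rewrite sqrrN.
Qed.

(** A row [p] with [p v = 1] is projected to the [lam]-eigenspace by averaging [lam^-k p K^k] over
    [k] modulo 4, where [lam^-k = lam^(4-k)]. The value at [v] is unchanged because
    [K v = lam v]. *)
Lemma dual_eigenvector (C : numClosedFieldType) n (K : 'M[C]_n) (lam : C)
    (v : 'cV[C]_n) :
  K ^+ 4 = 1 -> lam ^+ 4 = 1 -> v != 0 -> K *m v = lam *: v ->
  exists phi : 'rV[C]_n, phi *m K = lam *: phi /\ phi *m v = 1%:M.
Proof.
move=> K4 l4 v0 Kv.
have [p pv] : exists p : 'rV[C]_n, p *m v = 1%:M.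
  have /cV0Pn[i vi] := v0.
  exists ((v i 0)^-1 *: delta_mx 0 i); rewrite -scalemxAl -rowE.
  by apply/rowP=> j; rewrite !ord1 !mxE mulVf.
have pK4 : p *m K *m K *m K *m K = p.
  by rewrite -!mulmxA !mulmxE -!expr2 -!exprS K4 -idmxE mulmx1.
have four0 : (4 : C) != 0 by rewrite pnatr_eq0.
exists (4^-1 *: (p + lam ^+ 3 *: (p *m K) + lam ^+ 2 *: (p *m K *m K)
   + lam *: (p *m K *m K *m K))); split.
  rewrite -scalemxAl !mulmxDl -!scalemxAl pK4 [RHS]scalerA.
  rewrite [lam * _]mulrC -[RHS]scalerA; congr (_ *: _).
  rewrite !scalerDr !scalerA -!exprS -expr2 l4 scale1r.
  by rewrite addrC !addrA.
rewrite -scalemxAl !mulmxDl -!scalemxAl -!mulmxA !(Kv, =^~ scalemxAr) !pv.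
have l4' : lam * (lam * (lam * lam)) = 1.
  by rewrite -l4 !exprS expr0 mulr1.
rewrite !scalerA !exprS expr0 !mulr1 -!mulrA l4' scale1r.
by rewrite -!mulr2n -!mulrSr -scaler_nat scalerA mulVf ?scale1r.
Qed.

(** * Detection of vectors by morphisms into a topologising subcategory *)

Section Cogeneration.
Variables (C : numClosedFieldType) (N : nat) (D : qmodule C N -> Prop).
Hypothesis topD : topologising D.

Lemma qhom1 (V : qmodule C N) : qhom (1%:M : 'M[C]_(qdim V)).
Proof. by split=> *; rewrite mul1mx mulmx1. Qed.

Lemma topologising_sub V W : D V -> qsub W V -> D W.
Proof.
have [_ _ sq] := topD => DV WV; apply: (sq V) => //; exists W; split=> //.
by exists 1%:M; split; [exact: qhom1 | move=> y; exists y; rewrite mul1mx].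
Qed.

Lemma topologising_quo V W : D V -> qquo W V -> D W.
Proof.
have [_ _ sq] := topD => DV WV; apply: (sq V) => //; exists V; split=> //.
exists 1%:M; split; first exact: qhom1.
by move=> x y; rewrite !mul1mx.
Qed.

(** While a morphism to an object of [D] has a kernel vector, adjoining a morphism that detects this
    vector raises the rank. After at most [qdim V] steps [V] embeds into an object of [D]. *)
Lemma topologising_cogenerated V :
  (forall v : 'cV[C]_(qdim V), v != 0 ->
    exists W (A : 'M[C]_(qdim W, qdim V)), [/\ D W, qhom A & A *m v != 0]) ->
  D V.
Proof.
move=> cog; have [D0 DS _] := topD.
suff /(_ (qdim V)) [W [A [DW hA rA]]] : forall k, exists W (A : 'M[C]_(qdim W, qdim V)),
    [/\ D W, qhom A & row_full A \/ (k <= \rank A)%N].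
  apply: (topologising_sub DW); exists A; split=> // x y.
  have /row_fullP[B BA] : row_full A.
    by case: rA => // rA; rewrite /row_full eqn_leq rank_leq_col.
  by move/(congr1 (mulmx B)); rewrite !mulmxA BA !mul1mx.
elim=> [|k [W [A [DW hA rA]]]].
  exists (qzero C N), 0; split; [exact: D0 | | by right].
  by split=> *; rewrite mul0mx mulmx0.
have [fA|nfA] := boolP (row_full A).
  by exists W, A; split=> //; left.
have [v [v0 Av]] : exists v : 'cV[C]_(qdim V), v != 0 /\ A *m v = 0.
  have : cokermx A != 0.
    rewrite -mxrank_eq0 mxrank_coker subn_eq0 -ltnNge ltn_neqAle rank_leq_col.
    by rewrite andbT.
  move=> c0; have [j cj] : exists j, col j (cokermx A) != 0.
    apply/existsP; apply: contraNT c0 => /existsPn h; apply/eqP/matrixP=> i j.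
    by have /negPn/eqP/colP/(_ i) := h j; rewrite !mxE.
  by exists (col j (cokermx A)); split=> //; rewrite colE mulmxA mulmx_coker mul0mx.
have [W' [B [DW' hB Bv]]] := cog v v0.
exists (qsum W W'), (col_mx A B); split; [exact: DS | |right].
  have [a1 a2 a3] := hA; have [b1 b2 b3] := hB.
  by split=> * /=; rewrite /dsum mul_block_col mul_col_mx !mul0mx addr0 add0r
    ?a1 ?a2 ?a3 ?b1 ?b2 ?b3.
case: rA => [rA|rA]; first by rewrite rA in nfA.
apply: leq_ltn_trans rA _.
have AB : (A <= col_mx A B)%MS by rewrite -(addsmxE A B) addsmxSl.
rewrite ltn_neqAle mxrankS // andbT (mxrank_leqif_sup AB).
apply: contra Bv => h; have /submxP[Z BZ] : (B <= A)%MS.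
  by apply: submx_trans h; rewrite -(addsmxE A B) addsmxSr.
by rewrite BZ -mulmxA Av mulmx0.
Qed.

End Cogeneration.

(* If a_i b_i M = 0 with M the product over the other indices, then commuting
   with B_i gives b_i M = 0, and then commuting with A_i gives M = 0. *)
Lemma prod_pair_eq0 (R : pzRingType) (I : eqType) (a b A B : I -> R) (s : seq I) :
  (forall i j, B j * a i + a i * B j = (i == j)%:R) ->
  (forall i j, A j * b i + b i * A j = (i == j)%:R) ->
  (forall i j, B j * b i + b i * B j = 0) ->
  (forall i j, A j * a i + a i * A j = 0) ->
  uniq s -> \prod_(i <- s) (a i * b i) = 0 -> 1 = 0 :> R.
Proof.
move=> Ba Ab Bb Aa; elim: s => [|i s IH] /=; first by rewrite big_nil.
move=> /andP[si us]; rewrite big_cons => h; apply: IH => //.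
have sw (x y : R) : x * y + y * x = 0 -> x * y = - (y * x).
  by move=> e; apply/eqP; rewrite -addr_eq0 e.
have cm (x : R) : (forall j, j \in s -> x * a j = - (a j * x)) ->
    (forall j, j \in s -> x * b j = - (b j * x)) ->
    x * \prod_(j <- s) (a j * b j) = \prod_(j <- s) (a j * b j) * x.
  elim: s {si us h} => [|j s IH] xa xb; first by rewrite big_nil mulr1 mul1r.
  rewrite big_cons mulrA (mulrA x) xa ?mem_head // mulNr -(mulrA _ x).
  rewrite xb ?mem_head // mulrN opprK -!mulrA IH //.
  - by move=> k ks; apply: xa; rewrite inE ks orbT.
  - by move=> k ks; apply: xb; rewrite inE ks orbT.
have ne j : j \in s -> (j == i) = false.
  by apply: contraTF => /eqP->; exact: si.
have AM : A i * \prod_(j <- s) (a j * b j) = \prod_(j <- s) (a j * b j) * A i.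
  by apply: cm => j js; apply: sw; rewrite ?Aa // Ab ne.
have BM : B i * \prod_(j <- s) (a j * b j) = \prod_(j <- s) (a j * b j) * B i.
  by apply: cm => j js; apply: sw; rewrite ?Bb // Ba ne.
set M := \prod_(j <- s) _ in h AM BM *.
have bM : b i * M = 0.
  have : B i * (a i * b i * M) = b i * M + a i * b i * M * B i.
    have -> : B i * (a i * b i * M) = B i * a i * (b i * M) by rewrite !mulrA.
    have -> : B i * a i = 1 - a i * B i by apply/eqP; rewrite eq_sym subr_eq Ba eqxx.
    rewrite mulrBl mul1r -!mulrA (mulrA (B i)) (sw _ _ (Bb i i)).
    by rewrite mulNr mulrN opprK -BM -!mulrA.
  by rewrite h mulr0 mul0r addr0.
have : A i * (b i * M) = M - b i * M * A i.
  rewrite mulrA; have -> : A i * b i = 1 - b i * A i by apply/eqP; rewrite eq_sym subr_eq Ab eqxx.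
  by rewrite mulrBl mul1r -!mulrA AM.
by rewrite bM mulr0 mul0r subr0.
Qed.

(** * Quotient modules, the sign module and the parity shift *)

Section Constructions.
Variables (C : numClosedFieldType) (N : nat).
Implicit Types V W : qmodule C N.

(** A row free [B] is onto on column vectors, hence right cancellable, so the relations descend
    along it. *)
Lemma sf_relations_transfer n p (K : 'M[C]_n) (fp fm : 'I_N -> 'M[C]_n)
    (K' : 'M[C]_p) (fp' fm' : 'I_N -> 'M[C]_p) (B : 'M[C]_(p, n)) :
  sf_relations K fp fm -> row_free B -> K' *m B = B *m K ->
  (forall i, fp' i *m B = B *m fp i) -> (forall i, fm' i *m B = B *m fm i) ->
  sf_relations K' fp' fm'.
Proof.
move=> [rpK rmK rpm rpp rmm rK4] fB hK hp hm.
have M2 (x y : 'M[C]_p) (x' y' : 'M[C]_n) : x *m B = B *m x' ->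
    y *m B = B *m y' -> (x * y) *m B = B *m (x' * y').
  by move=> hx hy; rewrite -!mulmxE -mulmxA hy mulmxA hx mulmxA.
have A2 (x y : 'M[C]_p) (x' y' : 'M[C]_n) : x *m B = B *m x' ->
    y *m B = B *m y' -> (x * y + y * x) *m B = B *m (x' * y' + y' * x').
  by move=> hx hy; rewrite mulmxDl mulmxDr !(@M2 _ _ _ _ hx hy) !(@M2 _ _ _ _ hy hx).
have K2 := M2 _ _ _ _ hK hK.
have e1B : e1 K' *m B = B *m e1 K.
  rewrite /e1 -scalemxAl -scalemxAr mulmxBl mulmxBr !expr2 K2.
  by rewrite -!idmxE mul1mx mulmx1.
have inj := row_free_inj fB.
split=> [i|i|i j|i j|i j|]; apply: inj => /=.
- by rewrite (A2 _ _ _ _ (hp i) hK) rpK mulmx0 mul0mx.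
- by rewrite (A2 _ _ _ _ (hm i) hK) rmK mulmx0 mul0mx.
- by rewrite (A2 _ _ _ _ (hp i) (hm j)) rpm -scalemxAl -scalemxAr e1B.
- by rewrite (A2 _ _ _ _ (hp i) (hp j)) rpp mulmx0 mul0mx.
- by rewrite (A2 _ _ _ _ (hm i) (hm j)) rmm mulmx0 mul0mx.
- rewrite -idmxE mul1mx (exprM _ 2 2) !expr2 (M2 _ _ _ _ K2 K2) -!expr2 -exprM.
  by rewrite rK4 -idmxE mulmx1.
Qed.

(** The column span of [M] lies in the annihilator of the left kernel of [M], and both have
    dimension [\rank M]. *)
Lemma ker_row_base_kermx n k l (M : 'M[C]_(n, k)) (X : 'M[C]_(n, l)) :
  row_base (kermx M) *m X = 0 -> exists Y, X = M *m Y.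
Proof.
move=> bX; have kX : kermx M *m X = 0.
  have /submxP[Z ->] : (kermx M <= row_base (kermx M))%MS by rewrite eq_row_base.
  by rewrite -mulmxA bX mulmx0.
have sX : (X^T <= kermx (kermx M)^T)%MS.
  by apply/sub_kermxP; rewrite -trmx_mul kX trmx0.
have sM : (M^T <= kermx (kermx M)^T)%MS.
  by apply/sub_kermxP; rewrite -trmx_mul mulmx_ker trmx0.
have /submxP[Y XY] : (X^T <= M^T)%MS.
  apply: (submx_trans sX); rewrite -(mxrank_leqif_sup sM) mxrank_ker.
  by rewrite !mxrank_tr mxrank_ker subKn ?rank_leq_row.
by exists Y^T; rewrite -[X]trmxK XY trmx_mul trmxK.
Qed.

(** The rows of [B] form a basis of the left kernel of [M], so [B] is the projection modulo the
    column span of [M]; an operator [F] preserving this span descends to [B F B'] with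
    [B' = pinvmx B]. *)
Lemma quotient_module V k (M : 'M[C]_(qdim V, k)) :
  (exists Y, qK V *m M = M *m Y) ->
  (forall i, exists Y, qfp V i *m M = M *m Y) ->
  (forall i, exists Y, qfm V i *m M = M *m Y) ->
  exists W (B : 'M[C]_(qdim W, qdim V)),
    [/\ qhom B, row_free B, qdim W = (qdim V - \rank M)%N, B *m M = 0
      & forall l (X : 'M[C]_(qdim V, l)), B *m X = 0 -> exists Y, X = M *m Y].
Proof.
move=> sK sp sm; pose B := row_base (kermx M).
have fB : row_free B := row_base_free _.
have BM : B *m M = 0 by apply/sub_kermxP; rewrite eq_row_base.
pose q (F : 'M[C]_(qdim V)) := B *m F *m pinvmx B.
have qB F : (exists Y, F *m M = M *m Y) -> q F *m B = B *m F.
  move=> [Y FM]; rewrite /q mulmxKpV // eq_row_base; apply/sub_kermxP.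
  by rewrite -mulmxA FM mulmxA BM mul0mx.
have rel : sf_relations (q (qK V)) (fun i => q (qfp V i)) (fun i => q (qfm V i)).
  apply: (sf_relations_transfer (qrel V) fB) => [|i|i]; exact: qB.
exists (QModule rel), B; split=> //=.
- by split=> [|i|i] /=; rewrite qB.
- by rewrite mxrank_ker.
- by move=> l X; exact: ker_row_base_kermx.
Qed.

Lemma qquo_row_free V W (B : 'M[C]_(qdim W, qdim V)) :
  qhom B -> row_free B -> qquo W V.
Proof.
move=> hB fB; exists B; split=> // y; exists (pinvmx B *m y).
by rewrite mulmxA mulmxVp // mul1mx.
Qed.

Lemma sign_rel : sf_relations (-1 : 'M[C]_1) (fun _ : 'I_N => 0) (fun _ => 0).
Proof.
split=> *; rewrite ?(mulr0, mul0r, addr0) //.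
  by rewrite /e1 sqrrN expr1n subrr !scaler0.
by rewrite (exprM _ 2 2) sqrrN !expr1n.
Qed.

Definition qsign : qmodule C N := QModule sign_rel.

Lemma parity_rel V : sf_relations (- qK V) (qfp V) (qfm V).
Proof.
have [pK mK pm pp mm K4] := qrel V; split=> //.
- by move=> i; rewrite mulrN mulNr -opprD pK oppr0.
- by move=> i; rewrite mulrN mulNr -opprD mK oppr0.
- by move=> i j; rewrite pm /e1 sqrrN.
- by rewrite (exprM _ 2 2) sqrrN -exprM.
Qed.

Definition qparity V : qmodule C N := QModule (parity_rel V).

Lemma e1_sign : e1 (-1 : 'M[C]_1) = 0.
Proof. by rewrite /e1 sqrrN expr1n subrr scaler0. Qed.

(** With [sign] as second factor, whose [f]'s and [e1] vanish, the coproducts reduce to [- K] and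
    [f]. The cast identifies the dimensions [qdim V] and [qdim V * 1]. *)
Lemma qquo_parity V : qquo (qparity V) (qtens V qsign).
Proof.
pose e := esym (muln1 (qdim V)).
pose B : 'M[C]_(qdim V, qdim V * 1) := castmx (erefl, e) 1%:M.
have cB m (h : qdim V = m) (F : 'M[C]_(qdim V)) :
    castmx (erefl, h) 1%:M *m castmx (h, h) F = F *m castmx (erefl, h) 1%:M.
  by case: m / h; rewrite !castmx_id mul1mx mulmx1.
have tB (F : 'M[C]_(qdim V)) c : B *m (F *t (c%:M : 'M_1)) = (c *: F) *m B.
  by rewrite tens_mx_scalar cB.
have fB : row_free B.
  have aux m (h : qdim V = m) : row_free (castmx (erefl, h) 1%:M : 'M[C]_(_, m)).
    by case: m / h; rewrite castmx_id row_free_unit unitmx1.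
  exact: aux.
apply: (@qquo_row_free (qtens V qsign) (qparity V) B) => //.
have tp (w F : 'M[C]_(qdim V)) : B *m (F *t 1 + w *t (0 : 'M_1)) = F *m B.
  by rewrite tens0r addr0 -idmxE tB scale1r.
split=> [|i|i]; rewrite /= ?/tK ?/tfp ?/tfm /=; [|exact: tp..].
rewrite e1_sign mul0r tens0r scaler0 subr0.
have -> : (-1 : 'M[C]_1) = (-1)%:M by rewrite raddfN.
by rewrite tB scaleN1r.
Qed.

Lemma qK_id_f0 V : qK V = 1 -> (forall i, qfp V i = 0) /\ (forall i, qfm V i = 0).
Proof.
move=> K1; split=> i; apply: eq_opp0.
  by have := qfpK V i; rewrite K1 -idmxE mulmx1 mul1mx.
by have := qfmK V i; rewrite K1 -idmxE mulmx1 mul1mx.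
Qed.

Lemma qcopies_unit n : qdim (qcopies n (qunit C N)) = n
  /\ qK (qcopies n (qunit C N)) = 1.
Proof.
elim: n => [|n [d k]]; first by split=> //; apply/matrixP=> -[].
by split; [rewrite /= -[in RHS]d | rewrite /= k dsum1].
Qed.

Lemma qK_id_iso V W : qdim V = qdim W -> qK V = 1 -> qK W = 1 -> qiso V W.
Proof.
move=> d kV kW; have [pV mV] := qK_id_f0 kV; have [pW mW] := qK_id_f0 kW.
case: V W d kV kW pV mV pW mW => [m K fp fm r] [n K' fp' fm' r'] /= d.
case: n / d K' fp' fm' r' => K' fp' fm' r' K1 K1' p0 m0 p0' m0'.
exists 1%:M, 1%:M; split; rewrite ?mulmx1 //.
  by split=> [|i|i] /=; rewrite mul1mx mulmx1 ?(K1, K1', p0, p0', m0, m0').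
by split=> [|i|i] /=; rewrite mul1mx mulmx1 ?(K1, K1', p0, p0', m0, m0').
Qed.

Lemma qsign_neq_unit n : ~ qiso qsign (qcopies n (qunit C N)).
Proof.
have [_ k] := qcopies_unit n; move=> [A [B [[hA _ _] _ _ BA]]].
have A0 : A = 0.
  by apply: eq_opp0; have := hA; rewrite k /= mulmxN -!idmxE mulmx1 mul1mx.
have := congr1 (fun M : 'M_1 => M 0 0) BA; rewrite A0 mulmx0 !mxE.
by move/eqP; rewrite eq_sym oner_eq0.
Qed.

(** When [K ^ 2 = 1], all [f]'s anticommute, so every composition factor is one-dimensional with
    [K = 1] or [K = -1]. Induction on the dimension looks for a factor of the second kind. *)
Lemma sign_or_trivial (D : qmodule C N -> Prop) V : topologising D ->
  D V -> qK V ^+ 2 = 1 -> D qsign \/ qK V = 1.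
Proof.
move=> topD; have [n] := ubnP (qdim V); elim: n V => // n IH V dV DV K2.
have [d0|dpos] := posnP (qdim V).
  by right; apply/matrixP=> i; have := ltn_ord i; rewrite {2}d0.
have v0 : delta_mx (Ordinal dpos) 0 != 0 :> 'cV[C]_(qdim V).
  by apply/cV0Pn; exists (Ordinal dpos); rewrite mxE !eqxx oner_eq0.
pose F (i : 'I_N + 'I_N) := match i with inl i => qfp V i | inr i => qfm V i end.
have KF i : F i *m qK V = - (qK V *m F i) by case: i => i; rewrite /= (qfpK, qfmK).
have e10 : e1 (qK V) = 0 by rewrite /e1 K2 subrr scaler0.
have pm i j : qfp V i *m qfm V j = - (qfm V j *m qfp V i).
  by apply: swap_anti; rewrite (sf_fpfm (qrel V)) e10 scaler0.
have FF i j z : True -> F i *m (F j *m z) = - (F j *m (F i *m z)) :> 'cV_(qdim V).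
  move=> _; apply: mulmx_anti.
  by case: i j => [i|i] [j|j] /=; rewrite ?(qfpfp _ i) ?(qfmfm _ i) ?pm ?opprK.
(* An eigenvector of K killed by all f's spans a copy of sign or of the unit;
   in the latter case pass to the quotient by it. *)
have [x [x0 _ Fx]] := @common_kernel _ _ _ F (fun _ => True) _ FF
  (fun _ _ _ => I) v0 I.
have KKx y : qK V *m (qK V *m y) = 1 ^+ 2 *: y :> 'cV_(qdim V).
  by rewrite mulmxA mulmxE -expr2 K2 -idmxE mul1mx expr1n scale1r.
have [| |lam [y [ly y0 Fy Ky]]] := @sqr_eigenvector _ _ (qK V)
  (fun x => forall i, F i *m x = 0) 1 x _ _ (oner_neq0 _) x0 Fx (KKx x).
- by move=> c u w hu hw i; rewrite mulmxDr -scalemxAr hu hw scaler0 addr0.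
- by move=> u hu i; rewrite mulmxA KF mulNmx -mulmxA hu mulmx0 oppr0.
case: ly => l; rewrite {}l in Ky; last first.
  left; apply: (topologising_sub topD DV); exists (y : 'M[C]_(qdim V, qdim qsign)).
  split.
    split=> [|i|i] /=; rewrite ?mulmx0 ?mulmxN.
    + by rewrite Ky -idmxE mulmx1 scaleN1r.
    + exact: esym (Fy (inl i)).
    + exact: esym (Fy (inr i)).
  move=> c c' /= e; apply/colP=> k; rewrite ord1 {k}.
  have /cV0Pn[k yk] := y0; apply: (mulfI yk).
  by have := congr1 (fun M : 'cV_(qdim V) => M k 0) e; rewrite !mxE !big_ord1.
rewrite scale1r in Ky.
have [| | |W [B [hB fB dW By kB]]] := @quotient_module V 1 y.
- by exists 1%:M; rewrite Ky mulmx1.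
- by move=> i; exists 0; rewrite mulmx0; exact: Fy (inl i).
- by move=> i; exists 0; rewrite mulmx0; exact: Fy (inr i).
have DW : D W by apply: (topologising_quo topD DV); apply: qquo_row_free fB.
have [BK _ _] := hB.
have KW2 : qK W ^+ 2 = 1.
  apply: (row_free_inj fB); rewrite -idmxE mul1mx expr2 -mulmxE -mulmxA -BK mulmxA -BK.
  by rewrite -mulmxA mulmxE -expr2 K2 -idmxE mulmx1.
have dWn : (qdim W < n)%N.
  rewrite dW; rewrite ltnS in dV; apply: leq_trans dV.
  have ry : (0 < \rank y)%N by rewrite lt0n mxrank_eq0.
  by rewrite ltn_subrL ry dpos.
have [|KW] := IH W dWn DW KW2; first by left.
(* The image of [K - 1] lies in the line of [y], which [K] fixes, so [K - 1 = K (K - 1) = 1 - K]. *)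
right; have [|Y KY] := kB _ (qK V - 1).
  by rewrite mulmxBr BK KW -idmxE mul1mx -!idmxE mulmx1 subrr.
apply/eqP; rewrite -subr_eq0; apply/eqP/eq_opp0.
rewrite [LHS]KY -{1}Ky -mulmxA -KY mulmxBr mulmxE -expr2 K2 mulr1.
by rewrite opprB.
Qed.

End Constructions.

(** * The double braiding with the sign module *)

Section Transparency.
Variable C : numClosedFieldType.

(** The permutation behind [flip]: multiplication by [flip] becomes reindexing. *)
Definition swap_index m n (s : 'I_(m * n)) : 'I_(n * m) :=
  mxtens_index ((mxtens_unindex s).2, (mxtens_unindex s).1).

Lemma swap_indexK m n : cancel (@swap_index m n) (@swap_index n m).
Proof.
by move=> s; case: (mxtens_indexP s) => i j; rewrite /swap_index !mxtens_indexK.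
Qed.

Lemma flipE m n r s : flip C m n r s = (r == swap_index s)%:R.
Proof.
rewrite mxE -(can_eq (@mxtens_unindexK _ _)) /swap_index mxtens_indexK.
by case: (mxtens_unindex r) => a b; rewrite xpair_eqE.
Qed.

Lemma flip_mulmx m n k (X : 'M[C]_(m * n, k)) r s :
  (flip C m n *m X) r s = X (swap_index r) s.
Proof.
rewrite mxE (bigD1 (swap_index r)) //= flipE swap_indexK eqxx mul1r big1 ?addr0 //.
move=> t tr; rewrite flipE; case: eqP => [e|]; rewrite ?mul0r //.
by rewrite e swap_indexK eqxx in tr.
Qed.

Lemma mulmx_flip m n k (X : 'M[C]_(k, n * m)) r s :
  (X *m flip C m n) r s = X r (swap_index s).
Proof.
rewrite mxE (bigD1 (swap_index s)) //= flipE eqxx mulr1 big1 ?addr0 //.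
by move=> t /negPf ts; rewrite flipE ts mulr0.
Qed.

Lemma flip_flip m n : flip C n m *m flip C m n = 1%:M.
Proof. by apply/matrixP=> r s; rewrite flip_mulmx flipE mxE (can_eq (@swap_indexK _ _)). Qed.

Lemma flip_tens m n (A : 'M[C]_m) (B : 'M[C]_n) :
  flip C m n *m (A *t B) = (B *t A) *m flip C m n.
Proof.
apply/matrixP=> r s; rewrite flip_mulmx mulmx_flip.
case: (mxtens_indexP r) => r1 r2; case: (mxtens_indexP s) => s1 s2.
by rewrite /swap_index !mxtens_indexK !tensmxE mulrC.
Qed.

Variables (N : nat) (beta : C).
Implicit Types V W : qmodule C N.

(** As [e0 = 1] and [e1 = 0] on both factors, only [rho_{0,0}] remains, with coefficient [beta ^ 0].
    Each factor of the product is 1, as its correction contains [f_j^-] on [V] and [f_j^+] on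
    [W]. *)
Lemma Rmx_even V W : qK V ^+ 2 = 1 -> qK W ^+ 2 = 1 ->
  (forall i, qfm V i = 0) \/ (forall i, qfp W i = 0) ->
  Rmx beta V W = 2^-1 *: (1 + 1 *t qK W + qK V *t 1 - qK V *t qK W).
Proof.
move=> KV KW f0; rewrite /Rmx [X in _ * X]big1 => [|i _]; last first.
  by case: f0 => ->; rewrite ?mul0r ?tens0l ?tens0r scaler0 subr0.
have e0V n (K : 'M[C]_n) : K ^+ 2 = 1 -> e0 K = 1.
  by move=> K2; rewrite /e0 K2 -mulr2n -scaler_nat scalerA half2 scale1r.
have e1V n (K : 'M[C]_n) : K ^+ 2 = 1 -> e1 K = 0.
  by move=> K2; rewrite /e1 K2 subrr scaler0.
rewrite mulr1 !big_ord_recl !big_ord0 /e_ /= !addr0 !e0V ?e1V //.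
rewrite !tens0l !tens0r !mulr0 !scaler0 !addr0 tens11 mulr1 expr0 scale1r.
rewrite /rho !big_ord_recl !big_ord0 /= !addr0 /bump /= !muln0 !expr0 !expr1.
by rewrite invr1 !mulr1 !scale1r tens11 scaleN1r !addrA.
Qed.

(** The two R-matrices are [1 *t K] and [K *t 1], so the double braiding is the action of [K ^ 2] on
    [W]. *)
Lemma qsign_transparent W : qK W ^+ 2 = 1 ->
  trivial_double_braiding beta (qsign C N) W.
Proof.
move=> KW; have KS : (-1 : 'M[C]_1) ^+ 2 = 1 by rewrite sqrrN expr1n.
have half2x n (x : 'M[C]_n) : 2^-1 *: (x + x) = x.
  by rewrite -mulr2n -scaler_nat scalerA half2 scale1r.
have R1 : Rmx beta (qsign C N) W = 1 *t qK W.
  rewrite Rmx_even //=; last by left.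
  by rewrite !tensNl tens11 opprK [1 + _]addrC addrK half2x.
have R2 : Rmx beta W (qsign C N) = qK W *t 1.
  rewrite Rmx_even //=; last by right.
  by rewrite !tensNr tens11 opprK subrr add0r half2x.
rewrite /trivial_double_braiding /braiding R1 R2 -mulmxA flip_tens.
by rewrite (mulmxA (_ *t _)) mulmxE tensMM -expr2 KW mulr1 tens11 mul1mx flip_flip.
Qed.

End Transparency.

(** * The dichotomy between odd and even subcategories *)

Section Primality.
Variables (C : numClosedFieldType) (N : nat).
Implicit Types V W : qmodule C N.

(** Divide by the submodule [e0 V]: [e0] commutes with the action, and [K ^ 2 = e0 - e1] becomes
    [-1] modulo it. *)
Lemma odd_quotient V : e1 (qK V) != 0 ->
  exists W, [/\ qquo W V, qK W ^+ 2 = -1 & (0 < qdim W)%N].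
Proof.
have K4 := sf_K4 (qrel V); set K := qK V in K4 *; move=> e10.
have e1B : e1 K = 1 - e0 K by rewrite -(e0De1 K) addrAC subrr add0r.
have [| | |W [B [hB fB _ Be kB]]] := @quotient_module _ _ V _ (e0 K).
- by exists K; exact: comm_e0K.
- by move=> i; exists (qfp V i); apply: comm_e0f; exact: sf_fpK (qrel V) i.
- by move=> i; exists (qfm V i); apply: comm_e0f; exact: sf_fmK (qrel V) i.
have [BK _ _] := hB.
exists W; split; first exact: qquo_row_free fB.
  apply: (row_free_inj fB); rewrite /= mulNmx -idmxE mul1mx expr2 -mulmxE -mulmxA.
  rewrite -BK mulmxA -BK -mulmxA mulmxE -expr2 -e0Be1 //.
  by rewrite e1B !mulmxBr Be sub0r subr0 -idmxE mulmx1.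
rewrite lt0n; apply: contra_neq e10 => W0.
(* If the quotient were zero, [e0 Y = 1] would give [e1 = e1 e0 Y = 0]. *)
have [|Y eY] := kB _ 1%:M.
  by apply/matrixP=> i; have := ltn_ord i; rewrite {2}W0.
have -> : e1 K = e1 K *m (e0 K *m Y) by rewrite -eY mulmx1.
have e10 : e1 K *m e0 K = 0.
  by have := e0e1 K4; rewrite {1}e1B mulrBr {1}e1B mulmxBl mulr1 -idmxE mul1mx.
by rewrite mulmxA e10 mul0mx.
Qed.

(** On the square [K ^ 2 = 1], so its own [f]'s all anticommute. The auxiliary operators [f *t 1]
    detect the product: [omega] anticommutes with [f], so their anticommutators with the coproducts
    are those in [V], where [e1 = 1]. *)
Lemma odd_square_top V : qK V ^+ 2 = -1 -> (0 < qdim V)%N ->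
  \prod_(i <- enum 'I_N) (qfp (qtens V V) i * qfm (qtens V V) i) != 0.
Proof.
move=> K2 dV; have e11 : e1 (qK V) = 1.
  by rewrite /e1 K2 opprK -mulr2n -scaler_nat scalerA half2 scale1r.
pose A i : 'M[C]_(qdim V * qdim V) := qfp V i *t (1 : 'M[C]_(qdim V)).
pose B i : 'M[C]_(qdim V * qdim V) := qfm V i *t (1 : 'M[C]_(qdim V)).
have cr (x y w z : 'M[C]_(qdim V)) (c : C) : x * y + y * x = c *: (1 : 'M_(qdim V)) ->
    x * w + w * x = 0 ->
    (x *t 1) * (y *t 1 + w *t z) + (y *t 1 + w *t z) * (x *t 1)
    = c *: (1 : 'M[C]_(qdim V * qdim V)).
  move=> xy xw; rewrite mulrDr mulrDl !tensMM !mul1r !mulr1 addrACA -!tensDl xy xw.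
  by rewrite tens0l addr0 tensZl tens11.
have rV := qrel V.
have ap i := anti_omega_p (sf_fpK rV i).
have am i := anti_omega_m (sf_fpK rV i).
have bp i := anti_omega_p (sf_fmK rV i).
have bm i := anti_omega_m (sf_fmK rV i).
apply/eqP=> /(@prod_pair_eq0 _ _ _ _ A B) h.
have {h} : 1 = 0 :> 'M[C]_(qdim V * qdim V).
  apply: h; rewrite ?enum_uniq // => i j.
  - rewrite -[RHS](@scaler_nat C); apply: cr => //.
    by rewrite addrC (sf_fpfm rV) e11.
  - rewrite -[RHS](@scaler_nat C); apply: cr => //.
    by rewrite (sf_fpfm rV) e11 eq_sym.
  - rewrite -[RHS](scale0r (1 : 'M[C]_(qdim V * qdim V))); apply: cr => //.
    by rewrite (sf_fmfm rV) scale0r.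
  - rewrite -[RHS](scale0r (1 : 'M[C]_(qdim V * qdim V))); apply: cr => //.
    by rewrite (sf_fpfp rV) scale0r.
have d0 : (0 < qdim V * qdim V)%N by rewrite muln_gt0 dV.
move/matrixP/(_ (Ordinal d0) (Ordinal d0)); rewrite !mxE eqxx.
by move/eqP; rewrite oner_eq0.
Qed.

Variables (D : qmodule C N -> Prop) (beta : C).
Hypotheses (topD : topologising D) (tensD : tensor_subcategory D).

Lemma all_of_odd V : (0 < N)%N -> D V -> e1 (qK V) != 0 -> forall U, D U.
Proof.
move=> N0 DV eV; have [V1 [V1V K1 d1]] := odd_quotient eV.
have DV1 := topologising_quo topD DV V1V.
have [_ Dt] := tensD.
pose W0 := qtens V1 V1; have DW0 : D W0 by apply: Dt.
have T0 := odd_square_top K1 d1.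
have KW0 : qK W0 ^+ 2 = 1.
  by rewrite /= tK2 K1 tensNl tensNr opprK tens11.
have Ds : D (qsign C N).
  (* If [K = 1] on [W0], its [f]'s vanish, and so does the product in [T0], which has a factor
     because [N > 0]. *)
  have [//|KW1] := sign_or_trivial topD DW0 KW0.
  have [p0 m0] := qK_id_f0 KW1; case/eqP: T0.
  have : Ordinal N0 \in enum 'I_N by rewrite mem_enum.
  by case: (enum 'I_N) => // i s _; rewrite big_cons [qfp _ i]p0 !mul0r.
have Dpar W : D W -> D (qparity W).
  move=> DW; apply: (topologising_quo topD (Dt _ _ DW Ds)); exact: qquo_parity.
(* Targets for vectors killed by all [f]'s. The parity shift changes the eigenvalue and keeps the
   product of the [f]'s. *)
have top (lam : C) : lam = 1 \/ lam = -1 -> exists W (u : 'cV[C]_(qdim W)),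
    [/\ D W, qK W *m u = lam *: u
      & \prod_(i <- enum 'I_N) (qfp W i * qfm W i) *m u != 0].
  suff [mu [mu1 [u [Ku Tu]]]] : exists mu : C, (mu = 1 \/ mu = -1) /\
      exists u : 'cV[C]_(qdim W0), qK W0 *m u = mu *: u /\
        \prod_(i <- enum 'I_N) (qfp W0 i * qfm W0 i) *m u != 0.
    move=> l1; have [->|lmu] := eqVneq lam mu; first by exists W0, u.
    exists (qparity W0), u; split=> //=; first exact: Dpar.
    rewrite mulNmx Ku -scaleNr; congr (_ *: _).
    by case: l1 mu1 lmu => -> [] ->; rewrite ?eqxx ?opprK.
  set T := \prod_(i <- _) _ in T0 *.
  have [j Tj] : exists j, col j T != 0.
    apply/existsP; apply: contraNT T0 => /existsPn h; apply/eqP/matrixP=> i j.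
    by have /negPn/eqP/colP/(_ i) := h j; rewrite !mxE.
  rewrite colE in Tj; set c := delta_mx j 0 in Tj.
  have KKc : qK W0 *m (qK W0 *m c) = c.
    by rewrite mulmxA mulmxE -expr2 KW0 -idmxE mul1mx.
  (* The eigenvectors [c + K c] and [c - K c] add up to [2 c], so [T] cannot kill both. *)
  have [e|ne] := eqVneq (T *m (c + qK W0 *m c)) 0; last first.
    exists 1; split; first by left.
    by exists (c + qK W0 *m c); split=> //; rewrite mulmxDr KKc scale1r addrC.
  exists (-1); split; first by right.
  exists (c - qK W0 *m c); split.
    by rewrite mulmxBr KKc scaleN1r opprB.
  apply: contra_neq Tj => e'; apply: eq_opp0.
  have := congr2 +%R e e'; rewrite -mulmxDr addrACA subrr !addr0 mulmxDr.
  by move/eqP; rewrite addr_eq0 => /eqP.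
(* Targets for vectors with [K ^ 2 = -1] killed by all [f_i^-]. *)
have vac lam : lam = 'i \/ lam = - 'i -> exists W (u : 'cV[C]_(qdim W)),
    [/\ D W, qK W *m u = lam *: u, u != 0 & forall i, qfm W i *m u = 0].
  have v0 : delta_mx (Ordinal d1) 0 != 0 :> 'cV[C]_(qdim V1).
    by apply/cV0Pn; exists (Ordinal d1); rewrite mxE !eqxx oner_eq0.
  have [i j x _|x [x0 _ bx]] := @common_kernel _ _ _ (qfm V1) (fun _ => True) _ _
    (fun _ _ _ => I) v0 I; first exact/mulmx_anti/qfmfm.
  have KK (y : 'cV_(qdim V1)) : qK V1 *m (qK V1 *m y) = 'i ^+ 2 *: y.
    by rewrite mulmxA mulmxE -expr2 K1 mulNmx -idmxE mul1mx sqrCi scaleN1r.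
  have [| |mu [u [mu1 u0 bu Ku]]] := @sqr_eigenvector _ _ (qK V1)
    (fun x => forall i, qfm V1 i *m x = 0) 'i x _ _ (neq0Ci _) x0 bx (KK x).
  - by move=> c u w hu hw i; rewrite mulmxDr -scalemxAr hu hw scaler0 addr0.
  - by move=> u hu i; rewrite (mulmx_anti _ (qfmK V1 i)) hu mulmx0 oppr0.
  move=> l1; have [->|lmu] := eqVneq lam mu; first by exists V1, u.
  exists (qparity V1), u; split=> //=; first exact: Dpar.
  rewrite mulNmx Ku -scaleNr; congr (_ *: _).
  by case: l1 mu1 lmu => -> [] ->; rewrite ?eqxx ?opprK.
move=> U; apply: (topologising_cogenerated topD) => v v0; apply: contrapT => nv.
(* Vectors not detected by any morphism to an object of D form a submodule. *)
pose nd (x : 'cV[C]_(qdim U)) := forall W (A : 'M[C]_(qdim W, qdim U)),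
  D W -> qhom A -> A *m x = 0.
have ndv : nd v.
  by move=> W A DW hA; apply/eqP; apply: contra_notT nv => Av; exists W, A.
have ndD c x y : nd x -> nd y -> nd (c *: x + y).
  by move=> hx hy W A DW hA; rewrite mulmxDr -scalemxAr hx ?hy // scaler0 addr0.
have ndK x : nd x -> nd (qK U *m x).
  by move=> hx W A DW hA; have [h _ _] := hA; rewrite mulmxA h -mulmxA hx ?mulmx0.
have ndp i x : nd x -> nd (qfp U i *m x).
  by move=> hx W A DW hA; have [_ h _] := hA; rewrite mulmxA h -mulmxA hx ?mulmx0.
have ndm i x : nd x -> nd (qfm U i *m x).
  by move=> hx W A DW hA; have [_ _ h] := hA; rewrite mulmxA h -mulmxA hx ?mulmx0.
have K4 := sf_K4 (qrel U).
have KK4 : qK U *m qK U *m (qK U *m qK U *m v) = 1 ^+ 2 *: v.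
  by rewrite mulmxA !mulmxE -!expr2 -exprM K4 -idmxE mul1mx expr1n scale1r.
(* Since [K ^ 4 = 1], some undetected nonzero vector is an eigenvector of [K ^ 2], with eigenvalue
   [s = 1] or [s = -1]. *)
have [|s [x [s1 x0 ndx Kx]]] := @sqr_eigenvector _ _ (qK U *m qK U) nd 1 v ndD _
  (oner_neq0 _) v0 ndv KK4.
  by move=> y hy; rewrite -mulmxA; apply/ndK/ndK.
have {s1} s1 : s = 1 \/ s = -1 by case: s1 => ->; [left|right].
pose S y := nd y /\ qK U *m (qK U *m y) = s *: y.
have Sx : S x by split=> //; rewrite mulmxA.
have SD c y z : S y -> S z -> S (c *: y + z).
  move=> [ny Ky] [nz Kz]; split; first exact: ndD.
  by rewrite !mulmxDr -!scalemxAr Ky Kz scalerDr !scalerA mulrC.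
have SK y : S y -> S (qK U *m y).
  by move=> [ny Ky]; split; [exact: ndK | rewrite Ky -scalemxAr].
have SF (F : 'M[C]_(qdim U)) : F *m qK U = - (qK U *m F) ->
    (forall y, nd y -> nd (F *m y)) -> forall y, S y -> S (F *m y).
  move=> FK ndF y [ny Ky]; split; first exact: ndF.
  have := congr1 (mulmx F) Ky; rewrite !(mulmx_anti _ FK) mulmxN opprK.
  by rewrite -scalemxAr.
have Sp i := SF _ (qfpK U i) (ndp i).
have Sm i := SF _ (qfmK U i) (ndm i).
have e1S y : S y -> e1 (qK U) *m y = (2^-1 * (1 - s)) *: y.
  move=> [_ Ky]; rewrite /e1 -scalemxAl mulmxBl -idmxE mul1mx expr2 -mulmxE.
  by rewrite -mulmxA Ky -scalerA scalerBl scale1r.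
(* The rank one map [u phi] intertwines [K] because [u] and [phi] have the same eigenvalue. *)
have KX W (u : 'cV[C]_(qdim W)) lam (phi : 'rV[C]_(qdim U)) :
    qK W *m u = lam *: u -> phi *m qK U = lam *: phi ->
    qK W *m (u *m phi) = (u *m phi) *m qK U.
  by move=> Ku phiK; rewrite mulmxA Ku -mulmxA phiK -scalemxAl -scalemxAr.
have eig (I : finType) (F : I -> 'M[C]_(qdim U)) mu :
    (forall i j y, S y -> F i *m (F j *m y) = - (F j *m (F i *m y))) ->
    (forall i, F i *m qK U = - (qK U *m F i)) ->
    (forall i y, S y -> S (F i *m y)) -> mu != 0 -> s = mu ^+ 2 ->
    exists lam (y : 'cV[C]_(qdim U)), [/\ lam = mu \/ lam = - mu, y != 0, S y,
      forall i, F i *m y = 0 & qK U *m y = lam *: y].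
  move=> FF FK FS mu0 smu; have [y [y0 Sy Fy]] := common_kernel FF FS x0 Sx.
  have [||||lam [z [hl z0 [Sz Fz] Kz]]] := @sqr_eigenvector _ _ (qK U)
    (fun y => S y /\ forall i, F i *m y = 0) mu y _ _ mu0 y0.
  - move=> c u w [Su hu] [Sw hw]; split=> [|i]; first exact: SD.
    by rewrite mulmxDr -scalemxAr hu hw scaler0 addr0.
  - move=> u [Su hu]; split=> [|i]; first exact: SK.
    by rewrite (mulmx_anti _ (FK i)) hu mulmx0 oppr0.
  - by [].
  - by have [_ ->] := Sy; rewrite smu.
  - by exists lam, z.
have pow4 (lam mu : C) : lam = mu \/ lam = - mu -> mu ^+ 4 = 1 -> lam ^+ 4 = 1.
  by case=> -> // m4; rewrite (exprM _ 2 2) sqrrN -exprM.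
(* For [s = 1], [e1] vanishes on [S], so all the [f]'s anticommute there and have a common kernel
   vector. For [s = -1], [e1] is the identity on [S], and only the [f_i^-] are used. *)
case: s1 => s1.
- pose F (i : 'I_N + 'I_N) := match i with inl i => qfp U i | inr i => qfm U i end.
  have pm i j y : S y -> qfp U i *m (qfm U j *m y) = - (qfm U j *m (qfp U i *m y)).
    move=> Sy; have /(congr1 (mulmx^~ y)) := sf_fpfm (qrel U) i j.
    rewrite mulmxDl -!mulmxE -!mulmxA -scalemxAl e1S // s1 subrr mulr0 scale0r scaler0.
    by move/eqP; rewrite addr_eq0 => /eqP.
  have [||||| lam [y [hl y0 Sy Fy Ky]]] := @eig _ F 1.
  + case=> i [j|j] y Sy /=.
    * exact/mulmx_anti/qfpfp.
    * exact: pm.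
    * by rewrite [in RHS]pm // opprK.
    * exact/mulmx_anti/qfmfm.
  + by case=> i /=; rewrite (qfpK, qfmK).
  + by case=> i y; [exact: Sp | exact: Sm].
  + exact: oner_neq0.
  + by rewrite expr1n.
  have [W [u [DW Ku Tu]]] := top lam hl.
  have [phi [phiK phiy]] := dual_eigenvector K4 (pow4 _ _ hl (expr1n _ _)) y0 Ky.
  have hA := avgs_hom (KX _ _ _ _ Ku phiK).
  (* The averaged map sends [y] to the product of the [f]'s applied to [u], which is nonzero,
     although [y] is undetected. *)
  have [ndy _] := Sy; have := ndy _ _ DW hA.
  rewrite avgs_socle => [|i|i]; [|exact: Fy (inl i) | exact: Fy (inr i)].
  by rewrite -(mulmxA u) phiy mulmx1 => Tu0; rewrite Tu0 eqxx in Tu.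
- have [||||| lam [y [hl y0 Sy Fy Ky]]] := @eig _ (qfm U) 'i.
  + by move=> i j y Sy; exact/mulmx_anti/qfmfm.
  + exact: qfmK.
  + exact: Sm.
  + exact: neq0Ci.
  + by rewrite sqrCi.
  have [W [u [DW Ku u0 bu]]] := vac lam hl.
  have i4 : 'i ^+ 4 = 1 :> C by rewrite (exprM _ 2 2) sqrCi sqrrN expr1n.
  have [phi [phiK phiy]] := dual_eigenvector K4 (pow4 _ _ hl i4) y0 Ky.
  have hA := avgs_hom (KX _ _ _ _ Ku phiK).
  (* Here the averaged map sends [y] to [u] up to sign. *)
  have [ndy _] := Sy; have := ndy _ _ DW hA.
  rewrite avgs_vacuum ?enum_uniq // => [| |i].
  + rewrite -(mulmxA u) phiy mulmx1 => /eqP; rewrite scaler_eq0 signr_eq0 /=.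
    by rewrite (negPf u0).
  + by rewrite e1S // s1 opprK -mulr2n half2 scale1r.
  + by rewrite mulmxA bu mul0mx.
Qed.

(** Factorisability excludes [sign] from [D]: it would be transparent to [D], yet it is not a
    multiple of the unit. *)
Lemma vect_of_even : factorisable beta D ->
  (forall V, D V -> e1 (qK V) = 0) -> equivalent_to_Vect D.
Proof.
move=> facD e10 V DV.
have K2 W : D W -> qK W ^+ 2 = 1.
  by move/e10 => e; rewrite -e0Be1 -(e0De1 (qK W)) e subr0 addr0.
have [Ds|K1] := sign_or_trivial topD DV (K2 V DV).
  have [|n] := facD _ Ds; last by move/qsign_neq_unit.
  by move=> W DW; exact: qsign_transparent (K2 W DW).
have [d k] := qcopies_unit C N (qdim V).
by exists (qdim V); apply: qK_id_iso => //; rewrite d.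
Qed.

End Primality.

Unset Implicit Arguments.

Theorem proposition5p3 (R : realType) (N : nat) (beta : R[i])
  (hN : (1 <= N)%N) (hbeta : beta ^+ 4 = (-1) ^+ N) :
  prime_category N beta.
Proof.
move=> [D [topD tensD facD nall nVect]].
have [[V [DV eV]]|noV] := pselect (exists V, D V /\ e1 (qK V) != 0).
  apply: nall => U; exists U; split; first exact: all_of_odd topD tensD _ hN DV eV U.
  by exists 1%:M, 1%:M; split; rewrite ?mulmx1 //; exact: qhom1.
apply/nVect/(vect_of_even topD facD) => V DV.
by apply: contra_notP noV => /eqP eV; exists V.
Qed.
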